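(* Let $k\ge 1$, let $O$ be a point of the plane, and let $l=A_1\ldots A_{2k}$ be a closed polygonal line in the plane that does not pass through $O$ and is symmetric with respect to $O$, i.e. $O$ is the midpoint of the segment $A_jA_{k+j}$ for each $j=1,\ldots,k$. Then the winding number $w(l,O)$ of $l$ around $O$ is odd.
   Context: All points are in the plane $\mathbb{R}^2$. For points $A,B\neq O$ (possibly $A=B$), the oriented angle $\angle AOB$ is the number $t\in(-\pi,\pi]$ such that the vector $\overrightarrow{OB}$ is a positive multiple of the vector obtained from $\overrightarrow{OA}$ by counterclockwise rotation through $t$. A closed polygonal line $A_1\ldots A_m$ ($m\ge1$) is an ordered tuple of points, not necessarily distinct; with $A_{m+1}:=A_1$, it does not pass through $O$ if $O\notin\bigcup_{i=1}^m A_iA_{i+1}$ (union of segments). The winding number of a closed polygonal line $l=A_1\ldots A_m$ around a point $O$ not on it is $$w(l,O):=\frac{1}{2\pi}\sum_{i=1}^{m}\angle A_iOA_{i+1}.$$ *)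

(* Defs.v *)
From HB Require Import structures.
From mathcomp Require Import all_boot all_order all_algebra.
From mathcomp Require Import all_classical all_reals all_analysis.

Set Implicit Arguments.
Unset Strict Implicit.
Unset Printing Implicit Defensive.

Import Order.TTheory GRing.Theory Num.Theory.

Local Open Scope classical_set_scope.
Local Open Scope ring_scope.

Notation plane R := 'rV[R]_2.

Definition rotate (R : realType) (t : R) (v : plane R) : plane R :=
  \row_(i < 2) (if i == 0 then cos t * v 0 0 - sin t * v 0 1
                else sin t * v 0 0 + cos t * v 0 1).

Definition is_oangle (R : realType) (A O B : plane R) (t : R) : Prop :=
  - pi < t <= pi /\
  exists2 r : R, 0 < r & B - O = r *: rotate t (A - O).

(* [is_oangle A O B] holds for exactly one [t] when [A != O] and [B != O];
   otherwise the value below is irrelevant. *)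
Definition oangle (R : realType) (A O B : plane R) : R :=
  xget 0 [set t | is_oangle A O B t].

Definition segment (R : realType) (A B : plane R) : set (plane R) :=
  [set (1 - t) *: A + t *: B | t in `[0, 1]].

Definition midpoint (R : realType) (A B : plane R) : plane R :=
  2^-1 *: (A + B).

(* A closed polygonal line with [m] vertices is [l : m.-tuple (plane R)]. The
   vertices are indexed from 0, and [ordS] is the cyclic successor, so the side
   [i = m - 1] joins the last vertex to the first one. *)
Definition polyline_support (R : realType) (m : nat)
    (l : m.-tuple (plane R)) : set (plane R) :=
  \bigcup_(i in [set: 'I_m]) segment (tnth l i) (tnth l (ordS i)).

Definition winding_number (R : realType) (m : nat)
    (l : m.-tuple (plane R)) (O : plane R) : R :=
  (2 * pi)^-1 * \sum_(i < m) oangle (tnth l i) O (tnth l (ordS i)).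

(* [lshift k j] and [rshift k j] are the indices [j] and [k + j]. *)
Definition symmetric_polyline (R : realType) (k : nat)
    (l : (k + k).-tuple (plane R)) (O : plane R) : Prop :=
  forall j : 'I_k,
    O = midpoint (tnth l (lshift k j)) (tnth l (rshift k j)).

(* Main.v *)
(** Central symmetry preserves oriented angles, so the two halves of the line
    contribute the same angle sum [S] and the winding number is [S / pi].
    Composing the rotations along the first half turns the direction of
    [A_0 - O] into that of [A_k - O = - (A_0 - O)]; hence [cos S = -1] and [S]
    is an odd multiple of [pi]. *)

Require Import Defs.
From mathcomp Require Import all_boot all_order all_algebra.
From mathcomp Require Import all_classical all_reals all_analysis.
From mathcomp Require Import ring lra.

Set Implicit Arguments.
Unset Strict Implicit.
Unset Printing Implicit Defensive.

Import Order.TTheory GRing.Theory Num.Theory.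

Local Open Scope classical_set_scope.
Local Open Scope ring_scope.

Lemma cosD2piMz {R : realType} (n : int) (x : R) :
  cos (x + (pi *+ 2) *~ n) = cos x.
Proof.
case: n => n; first by rewrite -pmulrn (periodicn (@cosD2pi R)).
rewrite NegzE mulrNz -pmulrn.
by rewrite -[LHS](periodicn (@cosD2pi R) n.+1) -addrA addNr addr0.
Qed.

(** Subtracting whole turns brings [x] into one period, where the cosine takes the value -1 only at
    the centre [pi]. *)
Lemma cos_eqN1 {R : realType} (x : R) :
  cos x = -1 -> exists n : int, x = pi * (2 * n + 1)%:~R.
Proof.
move=> cosx; have pi_gt0 := pi_gt0 R.
pose n := Num.floor (x / (pi *+ 2)); exists n.
have pi2_gt0 : 0 < pi *+ 2 :> R by rewrite pmulrn_lgt0.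
have lex : n%:~R * (pi *+ 2) <= x by rewrite -ler_pdivlMr// floor_le.
have ltx : x < (n + 1)%:~R * (pi *+ 2) by rewrite -ltr_pdivrMr// floorD1_gt.
rewrite intrD mulr1z in ltx; rewrite -mulr_natr in lex ltx.
(* By the choice of [n], [y] lies in [[-pi, pi[]. Passing to its absolute value puts it in
   [[0, pi]], where [cos] is injective. *)
pose y := x - n%:~R * (pi * 2) - pi.
have cosy : cos `|y| = 1.
  rewrite cos_norm -(cosD2piMz n) /y.
  suff -> : x - n%:~R * (pi * 2) - pi + (pi *+ 2) *~ n = x - pi.
    by rewrite cosD cosN sinN cospi cosx sinpi; ring.
  by rewrite -mulrzr -mulr_natr; ring.
have y0 : `|y| = 0.
  apply: cos_inj; rewrite ?cos0// in_itv/= ?normr_ge0 ?lexx ?pi_ge0//=.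
  by rewrite ler_norml /y; apply/andP; split; lra.
move/eqP: y0; rewrite normr_eq0 => /eqP; rewrite /y => y0.
by rewrite intrD intrM; lra.
Qed.

(** The angle is [acos c], with the sign of [s]. *)
Lemma polar_angle {R : realType} (c s : R) : c ^+ 2 + s ^+ 2 = 1 ->
  exists t, [/\ - pi < t <= pi, cos t = c & sin t = s].
Proof.
move=> cs1; have pi_gt0 := pi_gt0 R.
have c1 : -1 <= c <= 1 by apply/andP; split; nra.
have sE : 1 - c ^+ 2 = s ^+ 2 by rewrite -cs1; ring.
have [s0|s0] := leP 0 s.
  exists (acos c); rewrite acosK ?in_itv// sin_acos// sE sqrtr_sqr ger0_norm//.
  split=> //; rewrite acos_lepi// andbT.
  by rewrite (lt_le_trans _ (acos_ge0 c1))// oppr_lt0.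
exists (- acos c).
rewrite cosN acosK ?in_itv// sinN sin_acos// sE sqrtr_sqr ltr0_norm// opprK.
(* Since [s] is nonzero here, [c] cannot be -1; this excludes the forbidden value [- pi]. *)
have c_gtN1 : -1 < c by nra.
split=> //; rewrite ltrN2 acos_ltpi /= ?c_gtN1 ?(andP c1).2//.
by rewrite (le_trans _ (ltW pi_gt0))// oppr_le0 acos_ge0.
Qed.

Lemma plane_eq {R : realType} (v w : plane R) :
  v 0 0 = w 0 0 -> v 0 1 = w 0 1 -> v = w.
Proof.
move=> h0 h1; apply/rowP => i.
by case: i => -[|[|//]] h;
  [rewrite (_ : Ordinal h = 0)|rewrite (_ : Ordinal h = 1)] => //;
  exact: val_inj.
Qed.

Lemma rotate_x {R : realType} (t : R) (v : plane R) :
  rotate t v 0 0 = cos t * v 0 0 - sin t * v 0 1.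
Proof. by rewrite mxE. Qed.

Lemma rotate_y {R : realType} (t : R) (v : plane R) :
  rotate t v 0 1 = sin t * v 0 0 + cos t * v 0 1.
Proof. by rewrite mxE. Qed.

Lemma rotate0 {R : realType} (v : plane R) : rotate 0 v = v.
Proof.
by apply: plane_eq; rewrite ?rotate_x ?rotate_y cos0 sin0; ring.
Qed.

Lemma rotateD {R : realType} (s t : R) (v : plane R) :
  rotate (s + t) v = rotate t (rotate s v).
Proof.
by apply: plane_eq; rewrite !(rotate_x, rotate_y) cosD sinD; ring.
Qed.

Lemma rotateZ {R : realType} (t r : R) (v : plane R) :
  rotate t (r *: v) = r *: rotate t v.
Proof.
by apply: plane_eq; rewrite !(rotate_x, rotate_y, mxE) /=; ring.
Qed.

Lemma rotateN {R : realType} (t : R) (v : plane R) :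
  rotate t (- v) = - rotate t v.
Proof. by rewrite -scaleN1r rotateZ scaleN1r. Qed.

Lemma sqnorm_gt0 {R : realType} (v : plane R) :
  v != 0 -> 0 < v 0 0 ^+ 2 + v 0 1 ^+ 2.
Proof.
move=> v0; rewrite lt_neqAle addr_ge0 ?sqr_ge0// andbT eq_sym.
rewrite paddr_eq0 ?sqr_ge0// !sqrf_eq0; apply: contra v0 => /andP[/eqP x0 /eqP y0].
by apply/eqP/plane_eq; rewrite mxE.
Qed.

(** The cosine and sine of the angle are the dot and cross products of the two vectors divided by
    the product of their lengths. *)
Lemma is_oangle_ex {R : realType} (A O B : plane R) :
  A != O -> B != O -> exists t, is_oangle A O B t.
Proof.
rewrite -(subr_eq0 A) -(subr_eq0 B) /is_oangle.
move: (A - O) (B - O) => v w /sqnorm_gt0 v0 /sqnorm_gt0 w0.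
set p := (_ + _) in v0; set q := (_ + _) in w0.
have a0 : 0 < Num.sqrt p by rewrite sqrtr_gt0.
have b0 : 0 < Num.sqrt q by rewrite sqrtr_gt0.
have a2 : Num.sqrt p ^+ 2 = p by rewrite sqr_sqrtr// ltW.
have b2 : Num.sqrt q ^+ 2 = q by rewrite sqr_sqrtr// ltW.
move: (Num.sqrt p) (Num.sqrt q) a0 b0 a2 b2 => a b a0 b0 a2 b2.
have an0 : a != 0 by rewrite gt_eqF.
have bn0 : b != 0 by rewrite gt_eqF.
have [|t [t_pi ct st]] := @polar_angle R
  ((v 0 0 * w 0 0 + v 0 1 * w 0 1) / (a * b))
  ((v 0 0 * w 0 1 - v 0 1 * w 0 0) / (a * b)).
  rewrite !expr_div_n -mulrDl exprMn a2 b2.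
  (* Lagrange's identity: the squares of the dot and cross products add up to the product of the
     squared lengths. *)
  have -> : (v 0 0 * w 0 0 + v 0 1 * w 0 1) ^+ 2 +
            (v 0 0 * w 0 1 - v 0 1 * w 0 0) ^+ 2 = p * q by rewrite /p /q; ring.
  by rewrite divff// mulf_neq0 ?gt_eqF.
exists t; split => //; exists (b / a); first exact: divr_gt0.
have scaleE x : b / a * (x / (a * b)) = x / p.
  by rewrite -a2; field; apply/andP.
have pn0 : p != 0 by rewrite gt_eqF.
by apply: plane_eq; rewrite mxE ?rotate_x ?rotate_y ct st ?mulrBr ?mulrDr;
  rewrite (mulrA (b / a) _ (v 0 0)) (mulrA (b / a) _ (v 0 1)) !scaleE; move: pn0; rewrite /p => pn0; field.
Qed.

Lemma oangleP {R : realType} (A O B : plane R) :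
  A != O -> B != O -> is_oangle A O B (oangle A O B).
Proof.
move=> A0 B0.
exact: (@xgetPex _ 0 [set t | is_oangle A O B t] (is_oangle_ex A0 B0)).
Qed.

(** Rotation commutes with negation, so both angles are chosen from the same set of [t]. *)
Lemma oangle_opp {R : realType} (A O B A' B' : plane R) :
  A' - O = - (A - O) -> B' - O = - (B - O) -> oangle A' O B' = oangle A O B.
Proof.
move=> A'E B'E; rewrite /oangle; congr xget; apply/seteqP.
split=> t /= [tpi [r r0 E]]; split => //; exists r => //.
  by apply: oppr_inj; rewrite -B'E E A'E rotateN scalerN.
by rewrite B'E E A'E rotateN scalerN.
Qed.

(** Rotations compose by adding angles, and the positive scaling factors multiply. *)
Lemma rotate_sum_oangle {R : realType} (O : plane R) (A : nat -> plane R)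
    (n : nat) : (forall i, A i != O) ->
  exists2 r : R, 0 < r &
    A n - O = r *: rotate (\sum_(i < n) oangle (A i) O (A i.+1)) (A 0%N - O).
Proof.
move=> AO; elim: n => [|n [r r0 IH]].
  by exists 1; rewrite ?ltr01// big_ord0 rotate0 scale1r.
have [_ [q q0 E]] := oangleP (AO n) (AO n.+1).
exists (q * r); first exact: mulr_gt0.
by rewrite big_ord_recr /= rotateD E IH rotateZ scalerA.
Qed.

Lemma cos_opposite {R : realType} (r t : R) (v : plane R) :
  0 < r -> v != 0 -> - v = r *: rotate t v -> cos t = -1.
Proof.
move=> r0 /sqnorm_gt0 v0 E.
have := congr1 (fun u : plane R => u 0 0) E.
have := congr1 (fun u : plane R => u 0 1) E.
rewrite !mxE /= => Ey Ex.
set p := (_ + _) in v0.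
(* Dot product of [v] with both sides of [E]. *)
have rc : r * cos t = -1.
  apply: (mulIf (lt0r_neq0 v0)).
  transitivity (v 0 0 * (r * (cos t * v 0 0 - sin t * v 0 1)) +
                v 0 1 * (r * (sin t * v 0 0 + cos t * v 0 1))).
    by rewrite /p; ring.
  by rewrite -Ex -Ey /p; ring.
(* Cross product of [v] with both sides of [E]. *)
have rs : r * sin t = 0.
  apply: (mulIf (lt0r_neq0 v0)).
  transitivity (v 0 0 * (r * (sin t * v 0 0 + cos t * v 0 1)) -
                v 0 1 * (r * (cos t * v 0 0 - sin t * v 0 1))).
    by rewrite /p; ring.
  by rewrite -Ex -Ey; ring.
have s0 : sin t = 0.
  by move/eqP: rs; rewrite mulf_eq0 gt_eqF//= => /eqP.
have /eqP := cos2Dsin2 t; rewrite s0 expr0n addr0 sqrf_eq1 => /orP[]/eqP// c1.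
by move: rc; rewrite c1 mulr1 => rE; move: r0; rewrite rE ltr0N1.
Qed.

Lemma polyline_vertex {R : realType} (m : nat) (l : m.-tuple (plane R))
    (i : 'I_m) : polyline_support l (tnth l i).
Proof.
exists i => //; exists 0; first by rewrite /= in_itv/= lexx ler01.
by rewrite subr0 scale1r scale0r addr0.
Qed.

Lemma symmetric_polyline_opp {R : realType} (k : nat) (O : plane R)
    (l : (k + k).-tuple (plane R)) (j : 'I_k) : symmetric_polyline l O ->
  tnth l (rshift k j) - O = - (tnth l (lshift k j) - O).
Proof.
move/(_ j); rewrite /midpoint => E.
by apply/rowP => i; have := congr1 (fun u : plane R => u 0 i) E; rewrite !mxE; lra.
Qed.

Theorem mainTheorem1 (R : realType) (k : nat) (O : plane R)
    (l : (k + k).-tuple (plane R)) :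
  (1 <= k)%N ->
  ~ polyline_support l O ->
  symmetric_polyline l O ->
  exists n : int, winding_number l O = (2 * n + 1)%:~R.
Proof.
move=> k1 lO sym.
have kk0 : (0 < k + k)%N by rewrite addn_gt0 k1.
(* Reducing indices modulo [k + k] turns the vertices into a periodic sequence on [nat], with [ordS]
   becoming the ordinary successor. *)
pose idx n : 'I_(k + k) := Ordinal (ltn_pmod n kk0).
pose A n := tnth l (idx n).
have AO n : A n != O.
  by apply/eqP => E; apply: lO; rewrite -E; exact: polyline_vertex.
have idxE (i : 'I_(k + k)) : idx i = i by apply: val_inj; rewrite /= modn_small.
have idxS (i : 'I_(k + k)) : idx i.+1 = ordS i by exact: val_inj.
(* The bound includes [j = k], where the index wraps around to 0: the last side of each half ends
   there. *)
have Asym j : (j <= k)%N -> A (k + j)%N - O = - (A j - O).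
  rewrite leq_eqVlt => /orP[/eqP ->|jk].
    have -> : A (k + k)%N = A 0%N.
      by congr (tnth l _); apply: val_inj; rewrite /= modnn mod0n.
    have := symmetric_polyline_opp (Ordinal k1) sym.
    rewrite -(idxE (rshift k (Ordinal k1))) -(idxE (lshift k (Ordinal k1))) /= addn0 => E.
    by rewrite [A k - O]E opprK.
  have := symmetric_polyline_opp (Ordinal jk) sym.
  by rewrite -(idxE (rshift k (Ordinal jk))) -(idxE (lshift k (Ordinal jk))).
pose S := \sum_(i < k) oangle (A i) O (A i.+1).
have sumE : \sum_(i < k + k) oangle (tnth l i) O (tnth l (ordS i)) = S *+ 2.
  transitivity (\sum_(i < k + k) oangle (A i) O (A i.+1)).
    by apply: eq_bigr => i _; rewrite /A idxE idxS.
  rewrite big_split_ord mulr2n; congr (_ + _); apply: eq_bigr => i _.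
  by apply: oangle_opp; rewrite /= -?addnS; apply: Asym; rewrite // ltnW.
have [r r0] := @rotate_sum_oangle R O A k AO.
(* Symmetry at [j = 0]: rotating [A 0 - O] through [S] gives a positive multiple of its opposite. *)
rewrite -{1}(addn0 k) Asym// -/S => Ek.
have A0O : A 0%N - O != 0 by rewrite subr_eq0.
have [n SE] := cos_eqN1 (cos_opposite r0 A0O Ek).
exists n; rewrite /winding_number sumE SE -mulr_natr.
have : pi != 0 :> R by rewrite gt_eqF ?pi_gt0.
by move: (pi) => p p0; field.
Qed.
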